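(* Let $k$ be a positive integer. For every natural number $n$, $$q_{2k}(8n+2k)=\delta_{2k}(n)=\sum_{\substack{a,b\in\mathbb{N}_0\\ a+2b=n}}r_k(a)\,\delta_k(b)=\sum_{\substack{a,b\in\mathbb{N}_0\\ a+2b=n}}r_k(a)\,q_k(8b+k).$$
   Context: $\mathbb{N}_0=\{0,1,2,\dots\}$. For $m\in\mathbb{N}_0$ and a positive integer $j$: $r_j(m)=\#\{\mathbf{y}\in\mathbb{Z}^j: m=\sum_{i=1}^j y_i^2\}$; $\delta_j(m)=\#\{\mathbf{z}\in\mathbb{N}_0^j: m=\sum_{i=1}^j\frac{z_i(z_i+1)}{2}\}$; $q_j(m)=\#\{\mathbf{y}\in\mathbb{Z}^j: m=\sum_{i=1}^j y_i^2,\ y_i\ge 0,\ y_i\text{ odd}\}$. *)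

(* Defs.v *)
From mathcomp Require Import all_boot all_order all_algebra.
From mathcomp Require Import finmap.
From mathcomp Require Import mathcomp_extra boolp classical_sets functions cardinality.

Import Order.TTheory GRing.Theory Num.Theory.

Local Open Scope classical_set_scope.
Local Open Scope nat_scope.

(* [fset_set] sends an infinite set to [fset0]; the lemmas
   [finite_*_set] below show that this default value is never used here. *)
Definition ncard {T : choiceType} (A : set T) : nat := #|` fset_set A|%fset.

Definition squares_set (j m : nat) : set {ffun 'I_j -> int} :=
  [set y | (m%:Z = \sum_(i < j) y i ^+ 2)%R].

Definition triangulars_set (j m : nat) : set {ffun 'I_j -> nat} :=
  [set z | m = \sum_(i < j) ((z i * (z i).+1) %/ 2)].

Definition odd_squares_set (j m : nat) : set {ffun 'I_j -> int} :=
  [set y | (m%:Z = \sum_(i < j) y i ^+ 2)%R /\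
           forall i, (0 <= y i)%R /\ (y i %% 2)%Z = 1%R].

Definition r (j m : nat) : nat := ncard (squares_set j m).
Definition delta (j m : nat) : nat := ncard (triangulars_set j m).
Definition q (j m : nat) : nat := ncard (odd_squares_set j m).

Lemma finite_bounded_ffun (T : choiceType) (j N : nat) (f : 'I_N -> T)
    (A : set {ffun 'I_j -> T}) :
  (forall y, A y -> forall i, exists k, y i = f k) -> finite_set A.
Proof.
move=> Af.
pose F (g : {ffun 'I_j -> 'I_N}) : {ffun 'I_j -> T} := [ffun i => f (g i)].
apply: (@sub_finite_set _ _ (F @` setT)); last first.
  exact/finite_image/finite_finset.
move=> y Ay; have [g gE] := choice (Af y Ay).
by exists [ffun i => g i] => //; apply/ffunP => i; rewrite !ffunE gE.
Qed.

Lemma finite_squares_set (j m : nat) : finite_set (squares_set j m).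
Proof.
pose f (k : 'I_(m.+1 + m.+1)) : int :=
  match fintype.split k with inl a => Posz a | inr b => (- Posz b)%R end.
apply: (@finite_bounded_ffun _ _ _ f) => y /= yE i.
have lt_m : `|y i|%N < m.+1.
  rewrite ltnS -lez_nat yE (bigD1 i) //= ler_wpDr //.
    by apply: sumr_ge0 => l _; exact: sqr_ge0.
  rewrite -[(y i ^+ 2)%R]gez0_abs ?sqr_ge0 // abszX lez_nat.
  by case: `|y i|%N => // a; rewrite expnS expn1 leq_pmulr.
case: (lerP 0%R (y i)) => yi0.
  exists (lshift _ (Ordinal lt_m)).
  by rewrite /f (unsplitK (inl _)) /= gez0_abs.
exists (rshift _ (Ordinal lt_m)).
by rewrite /f (unsplitK (inr _)) /= ltz0_abs // opprK.
Qed.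

Lemma finite_odd_squares_set (j m : nat) : finite_set (odd_squares_set j m).
Proof. by apply: sub_finite_set (finite_squares_set j m) => y []. Qed.

Lemma finite_triangulars_set (j m : nat) : finite_set (triangulars_set j m).
Proof.
apply: (@finite_bounded_ffun _ _ m.+1 (@nat_of_ord _)) => z /= zE i.
suff lt_m : z i < m.+1 by exists (Ordinal lt_m).
rewrite ltnS zE (bigD1 i) //= (leq_trans _ (leq_addr _ _)) //.
case: (z i) => // a; rewrite leq_divRL // leq_mul2l; by [].
Qed.

(* Main.v *)
Require Import Defs.
From mathcomp Require Import all_boot.
From mathcomp Require Import all_algebra finmap zify.
From mathcomp Require Import boolp classical_sets functions cardinality.

Import GRing.Theory Num.Theory.

(** Writing [T z] for the triangular number [z (z + 1) / 2], extended to negative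
    [z] by the same formula, one has [T (b + a) + T (b - a) = a ^ 2 + 2 T b].
    Since [T (- t - 1) = T t], folding [t < 0] onto [- t - 1] turns
    [(a, b) |-> (b + a, b - a)] into a bijection from [int * nat] to [nat * nat].
    Applied coordinatewise it matches the representations of [n] by [2k] triangular
    numbers with the pairs (vector of [k] integers, [k] triangular numbers).
    Odd squares are handled by [(2 z + 1) ^ 2 = 8 T z + 1]. *)

Local Open Scope ring_scope.
Local Open Scope nat_scope.

Section Ncard.
Local Open Scope classical_set_scope.

Lemma ncard_preimage (T U : choiceType) (f : T -> U) (A : set U) :
  injective f -> range f = setT -> finite_set A ->
  ncard (f @^-1` A) = ncard A.
Proof.
move=> f_inj f_surj finA.
rewrite /ncard -[in RHS](image_preimage A f_surj) fset_set_image.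
  by rewrite card_imfset.
by apply: finite_preimage => // x y _ _; apply: f_inj.
Qed.

Lemma ncard_image (T U : choiceType) (f : T -> U) (A : set T) :
  injective f -> finite_set A -> ncard (f @` A) = ncard A.
Proof.
by move=> f_inj finA; rewrite /ncard fset_set_image // card_imfset.
Qed.

Lemma ncard_setX (T U : choiceType) (A : set T) (B : set U) :
  finite_set A -> finite_set B -> ncard (A `*` B) = ncard A * ncard B.
Proof.
move=> finA finB; rewrite /ncard fset_setX // -(size_allpairs pair).
apply/perm_size/uniq_perm; first exact: fset_uniq.
  by apply: allpairs_uniq; rewrite ?fset_uniq // => -[? ?] [? ?] _ _ [-> ->].
move=> [x y]; rewrite in_fsetM /=.
by apply/andP/allpairsP => [[xA yB]|[[x' y'] [/= xA yB [-> ->]]]];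
  [exists (x, y)|].
Qed.

(** Fibre counting. It is applied with [h] recording a pair of values [(a, b)], so that each fibre
    yields one term of the convolution. *)
Lemma ncard_partition (T : choiceType) (I : finType) (h : T -> I) (A : set T) :
  finite_set A -> ncard A = \sum_i ncard [set x | A x /\ h x = i].
Proof.
move=> finA; rewrite /ncard card_fset_sum1 (partition_big h xpredT) //=.
apply: eq_bigr => i _.
rewrite card_fset_sum1 [LHS]big_seq_cond [RHS]big_seq_cond.
have fin_i : finite_set [set x | A x /\ h x = i].
  by apply: sub_finite_set finA => x [].
rewrite -!big_seq_cond -[LHS]big_filter; apply/perm_big/uniq_perm.
- by rewrite filter_uniq // fset_uniq.
- exact: fset_uniq.
move=> x; rewrite mem_filter !in_fset_set //.
apply/andP/idP => [[/eqP hx /set_mem Ax]|/set_mem[Ax hx]].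
  exact/mem_set.
by split; [exact/eqP|exact/mem_set].
Qed.

End Ncard.

Definition triangular (z : nat) : nat := (z * z.+1) %/ 2.

Lemma triangularE (z : nat) : 2 * triangular z = z * z.+1.
Proof.
rewrite mulnC divnK // dvdn2 oddM /=; by case: (odd z).
Qed.

Lemma sqr_odd (z : nat) :
  (((2 * z + 1)%N%:Z ^+ 2) = (8 * triangular z + 1)%N%:Z)%R.
Proof. have := triangularE z; rewrite expr2; nia. Qed.

(** The map [z |-> 2 z + 1] is a bijection from the naturals onto the nonnegative odd integers. Each
    of the [j] coordinates contributes the [1] of [8 T + 1], whence the shift by [j]. *)
Lemma q_delta (j m : nat) : q j (8 * m + j) = delta j m.
Proof.
pose f (z : {ffun 'I_j -> nat}) : {ffun 'I_j -> int} :=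
  [ffun i => (2 * z i + 1)%N%:Z].
have f_inj : injective f.
  move=> z z' /ffunP eq_f; apply/ffunP => i.
  have := eq_f i; rewrite !ffunE => -[].
  by move=> /addIn/eqP; rewrite eqn_pmul2l // => /eqP.
have sum_f z : (\sum_(i < j) f z i ^+ 2)%R
    = (8 * (\sum_(i < j) triangular (z i)) + j)%N%:Z.
  under eq_bigr do rewrite ffunE sqr_odd.
  rewrite -(big_morph Posz PoszD (erefl _)); congr Posz.
  by rewrite big_split /= -big_distrr /= sum1_card card_ord.
rewrite /q /delta -(ncard_image _ _ f) //; last exact: finite_triangulars_set.
congr ncard; apply/seteqP; split => [y [yE y_odd]|_ [z zE <-]]; last first.
  split=> [|i]; last by rewrite ffunE; lia.
  by rewrite sum_f /triangular -zE.
pose z : {ffun 'I_j -> nat} := [ffun i => `|y i|%N./2].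
have yf : f z = y.
  have odd_intE (t : int) : (0 <= t -> (t %% 2)%Z = 1 ->
      (2 * `|t|%N./2 + 1)%N%:Z = t)%R by lia.
  by apply/ffunP => i; rewrite !ffunE; case: (y_odd i) => /odd_intE.
exists z => //=; move: yE; rewrite -yf sum_f; case.
by move=> /addIn/eqP; rewrite eqn_pmul2l // => /eqP.
Qed.

(* [Negz n] denotes [- n - 1]. *)
Definition fold_int (t : int) : nat :=
  match t with Posz n | Negz n => n end.

(** A linear form of the folding, on which [lia] can split cases. *)
Lemma fold_intP (t : int) :
  (t = fold_int t \/ t = - (fold_int t)%:Z - 1)%R.
Proof. case: t => t /=; lia. Qed.

Lemma fold_int_oppB1 (m : nat) : fold_int (- m%:Z - 1)%R = m.
Proof. have := fold_intP (- m%:Z - 1)%R; lia. Qed.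

Lemma triangular_fold_int (t : int) :
  (2 * (triangular (fold_int t))%:Z = t * (t + 1))%R.
Proof.
have := triangularE (fold_int t); have := fold_intP t.
by move: (fold_int t) => z; case=> -> zE; rewrite mulrDr; nia.
Qed.

(** As [(b + a) + (b - a) = 2 b >= 0], at most one of the two is negative. Folding flips parity, so
    the folded values [u], [v] have an odd sum exactly when one fold occurred. In that case
    [2 b = |u - v| - 1], and the smaller value is the folded one. *)
Lemma fold_int_inj (a a' : int) (b b' : nat) :
  fold_int (b%:Z + a)%R = fold_int (b'%:Z + a')%R ->
  fold_int (b%:Z - a)%R = fold_int (b'%:Z - a')%R -> a = a' /\ b = b'.
Proof.
have := fold_intP (b%:Z + a)%R; have := fold_intP (b%:Z - a)%R.
have := fold_intP (b'%:Z + a')%R; have := fold_intP (b'%:Z - a')%R.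
lia.
Qed.

Lemma fold_int_surj (u v : nat) : exists ab : int * nat,
  fold_int (ab.2%:Z + ab.1)%R = u /\ fold_int (ab.2%:Z - ab.1)%R = v.
Proof.
(* Solving [b + a = s] and [b - a = t] gives [a = s - b], provided [s + t = 2 b]. *)
have E (s t : int) (b : nat) : (s + t = b%:Z + b%:Z)%R ->
    (fold_int s = u) -> fold_int t = v -> exists ab : int * nat,
  fold_int (ab.2%:Z + ab.1)%R = u /\ fold_int (ab.2%:Z - ab.1)%R = v.
  move=> stE su tv; exists ((s - b%:Z)%R, b) => /=.
  have -> : (b%:Z + (s - b%:Z) = s)%R by lia.
  by have -> : (b%:Z - (s - b%:Z) = t)%R by lia.
have [even_uv|odd_uv] := boolP (odd (u + v) == false).
  by apply: (E u%:Z v%:Z (u + v)./2) => //; lia.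
(* For an odd sum the smaller value is unfolded to its negative preimage. The difference being odd,
   its rounded half is [b = (|u - v| - 1) / 2]. *)
have [le_uv|lt_vu] := leqP u v.
  apply: (E (- u%:Z - 1)%R v%:Z (v - u)./2) => //; first lia.
  exact: fold_int_oppB1.
apply: (E u%:Z (- v%:Z - 1)%R (u - v)./2) => //; first lia.
exact: fold_int_oppB1.
Qed.

Lemma triangular_fold_intD (a : int) (b : nat) :
  ((triangular (fold_int (b%:Z + a)))%:Z
   + (triangular (fold_int (b%:Z - a)))%:Z
   = a ^+ 2 + 2 * (triangular b)%:Z)%R.
Proof.
have := triangular_fold_int (b%:Z + a)%R.
have := triangular_fold_int (b%:Z - a)%R.
have := triangularE b; rewrite expr2; nia.
Qed.

Section FoldPair.
Variable k : nat.
Implicit Type p : {ffun 'I_k -> int} * {ffun 'I_k -> nat}.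

(** Indexing by [k + k] rather than [2 * k] lets [fintype.split] separate the two blocks. *)
Definition fold_pair p : {ffun 'I_(k + k) -> nat} :=
  [ffun i => match fintype.split i with
             | inl l => fold_int ((p.2 l)%:Z + p.1 l)%R
             | inr l => fold_int ((p.2 l)%:Z - p.1 l)%R
             end].

Lemma fold_pair_lshift p i :
  fold_pair p (lshift k i) = fold_int ((p.2 i)%:Z + p.1 i)%R.
Proof. by rewrite ffunE (unsplitK (inl _)). Qed.

Lemma fold_pair_rshift p i :
  fold_pair p (rshift k i) = fold_int ((p.2 i)%:Z - p.1 i)%R.
Proof. by rewrite ffunE (unsplitK (inr _)). Qed.

Lemma fold_pair_inj : injective fold_pair.
Proof.
move=> [y z] [y' z'] /ffunP eqF.
have eq_yz i : y i = y' i /\ z i = z' i.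
  apply: fold_int_inj.
    by have := eqF (lshift k i); rewrite !fold_pair_lshift.
  by have := eqF (rshift k i); rewrite !fold_pair_rshift.
by congr pair; apply/ffunP => i; have [] := eq_yz i.
Qed.

Lemma fold_pair_surj (w : {ffun 'I_(k + k) -> nat}) : exists p, fold_pair p = w.
Proof.
have [g gE] := choice (fun i => fold_int_surj (w (lshift k i)) (w (rshift k i))).
exists ([ffun i => (g i).1], [ffun i => (g i).2]).
apply/ffunP => i; rewrite -(splitK i); case: (fintype.split i) => l /=.
  by rewrite fold_pair_lshift !ffunE; have [] := gE l.
by rewrite fold_pair_rshift !ffunE; have [] := gE l.
Qed.

Lemma sum_triangular_fold_pair p :
  ((\sum_i triangular (fold_pair p i))%N%:Z
   = \sum_i p.1 i ^+ 2 + 2 * (\sum_i triangular (p.2 i))%N%:Z)%R.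
Proof.
rewrite !(big_morph Posz PoszD (erefl _)) big_split_ord /=.
rewrite -big_split mulr_sumr -big_split /=.
apply: eq_bigr => i _; rewrite fold_pair_lshift fold_pair_rshift.
exact: triangular_fold_intD.
Qed.

End FoldPair.

Lemma delta_double (k n : nat) :
  delta (k + k) n =
    \sum_(a < n.+1) \sum_(b < n.+1 | a + 2 * b == n) r k a * delta k b.
Proof.
pose norm2 (y : {ffun 'I_k -> int}) : nat := `|(\sum_i y i ^+ 2)%R|%N.
pose tri (z : {ffun 'I_k -> nat}) : nat := \sum_i triangular (z i).
have norm2E y : ((norm2 y)%:Z = \sum_i y i ^+ 2)%R.
  by rewrite /norm2 gez0_abs // sumr_ge0 // => i _; exact: sqr_ge0.
have foldE p : triangulars_set (k + k) n (fold_pair k p) <->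
    norm2 p.1 + 2 * tri p.2 = n.
  have -> : triangulars_set (k + k) n (fold_pair k p) =
    (n = \sum_i triangular (fold_pair k p i)) by [].
  have := sum_triangular_fold_pair k p; rewrite -norm2E -/(tri p.2).
  by move: (\sum_i _) => w; lia.
rewrite /delta -(ncard_preimage _ _ (fold_pair k));
  [|exact: fold_pair_inj| |exact: finite_triangulars_set]; last first.
  by apply/seteqP; split=> // w _; have [p <-] := fold_pair_surj k w; exists p.
(* [inord] sends values above [n] to the default [0]. This never happens on the set counted, where
   [norm2 p.1 + 2 * tri p.2 = n] bounds both values by [n]. *)
pose h (p : {ffun 'I_k -> int} * {ffun 'I_k -> nat}) : 'I_n.+1 * 'I_n.+1 :=
  (inord (norm2 p.1), inord (tri p.2)).
have hE p a b : norm2 p.1 + 2 * tri p.2 = n ->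
    h p = (a, b) <-> norm2 p.1 = a /\ tri p.2 = b.
  rewrite /h; move: (norm2 _) (tri _) => u v uvn; split; last first.
    by move=> [-> ->]; rewrite !inord_val.
  by case=> <- <-; rewrite !inordK; lia.
rewrite (ncard_partition _ _ h); last first.
  apply: finite_preimage; last exact: finite_triangulars_set.
  by move=> ? ? _ _; apply: fold_pair_inj.
rewrite pair_big_dep [RHS]big_mkcond /=.
(* If [a + 2 b] differs from [n] the fibre is empty, matching a zero term on the right. Otherwise
   the equation for [n] follows from those for [a] and [b], so the fibre is a full product. *)
apply: eq_bigr => -[a b] _ /=; case: eqP => [abn|abn]; last first.
  rewrite (_ : [set p | _ /\ _]%classic = set0) /ncard ?fset_set0 //.
  apply/seteqP; split=> // p /= [/foldE pn /(hE _ _ _ pn)[ya zb]].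
  by apply: abn; rewrite -ya -zb.
rewrite -[RHS]ncard_setX;
  [|exact: finite_squares_set|exact: finite_triangulars_set].
congr ncard; apply/seteqP; split=> -[y z] /=.
  move=> [/foldE pn /(hE _ _ _ pn)[/= ya zb]].
  by split; rewrite -?ya -?zb -?norm2E.
rewrite /squares_set /= -norm2E => -[[ya] zb].
have pn : norm2 (y, z).1 + 2 * tri (y, z).2 = n by rewrite -abn ya zb.
by split; [exact/foldE|exact/hE].
Qed.

Theorem corollary1p7 (k : nat) (hk : 0 < k) (n : nat) :
  [/\ q (2 * k) (8 * n + 2 * k) = delta (2 * k) n,
      delta (2 * k) n =
        \sum_(a < n.+1) \sum_(b < n.+1 | a + 2 * b == n) r k a * delta k b
    & \sum_(a < n.+1) \sum_(b < n.+1 | a + 2 * b == n) r k a * delta k b =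
        \sum_(a < n.+1) \sum_(b < n.+1 | a + 2 * b == n)
          r k a * q k (8 * b + k)].
Proof.
split; first exact: q_delta.
  by rewrite mul2n -addnn; exact: delta_double.
by apply: eq_bigr => a _; apply: eq_bigr => b _; rewrite q_delta.
Qed.
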